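(* The morphism $\mathcal{T}_{\lambda\to\mathrm{P}}=(T,\alpha,\beta)$ from the $\lambda$-calculus to propositional logic is surjective on the space of all proofs. In detail: for every propositional signature $\Sigma_{\mathrm{P}}$, every propositional judgement $J_{\mathrm{P}}\in \mathrm{Sen}^{\mathrm{P}}\Sigma_{\mathrm{P}}$ and every proof $\rho_{\mathrm{P}}\in\pi^{\mathrm{P}}_{\Sigma_{\mathrm{P}}}(J_{\mathrm{P}})$, there exist a $\lambda$-signature $\Sigma_\lambda$, a $\lambda$-judgement $J_\lambda\in\mathrm{Sen}^\lambda\Sigma_\lambda$ and a proof $\rho_\lambda\in\pi^\lambda_{\Sigma_\lambda}(J_\lambda)$ such that $$T(\Sigma_\lambda)=\Sigma_{\mathrm{P}},\qquad \alpha_{\Sigma_\lambda}(J_\lambda)=J_{\mathrm{P}},\qquad \beta_{\Sigma_\lambda,J_\lambda}(\rho_\lambda)=\rho_{\mathrm{P}}.$$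
   Context: **Deductive systems and proofs.** An inference over a type $\mathcal{J}$ of judgements is an indexed family of elements of $\mathcal{J}$ (its hypotheses) together with an element of $\mathcal{J}$ (its conclusion). A ruleset over $\mathcal{J}$ is an indexed family of inferences over $\mathcal{J}$. Given a ruleset, the type of proofs (deductions) of each judgement is freely (inductively) generated: given an index of a rule and, for each hypothesis of that rule, a proof of this hypothesis, one obtains a proof of the conclusion. Thus proofs are well-founded trees whose nodes are labelled by rule indices. Below, the index of a rule consists of its displayed name together with all the data over which the rule is quantified (contexts, propositions, variables, terms, etc.). ''Type'' may be read as ''set''. **Propositional logic.** A propositional signature is a tuple $\Sigma=(\mathcal{C},\#,\mathcal{R},\mathcal{H},\mathcal{V})$, where $\mathcal{C}$ is a type of connectives; $\#:\mathcal{C}\to\mathbb{N}$ is an arity function; $\mathcal{R}$ assigns to each connective $c$ a type $\mathcal{R}(c)$ of rules; $\mathcal{H}$ assigns to each $c\in\mathcal{C}$ and $r\in\mathcal{R}(c)$ a header $\mathcal{H}_c(r)$, a list of length $\#c$ with entries in $\{\mathsf{true},\mathsf{prop}\}$, with entries denoted $\mathcal{H}_c(r)[i]$ for $0\le i<\#c$; and $\mathcal{V}$ is a type of propositional variables. Propositions over $\Sigma$ are built inductively: each $p\in\mathcal{V}$ is a proposition, and $c(P_0,\dots,P_{\#c-1})$ is a proposition for $c\in\mathcal{C}$ and propositions $P_i$. A context $\Gamma$ is a finite list of propositions. $\mathrm{Sen}^{\mathrm{P}}\Sigma$ is the type of judgements $\Gamma\vdash P\ \mathsf{true}$ and $\Gamma\vdash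 P\ \mathsf{prop}$, where $\Gamma$ is a context and $P$ is a proposition. $\pi^{\mathrm{P}}_\Sigma(J)$ is the type of proofs of $J$ from the following rules (for all contexts $\Gamma$, propositions $P,P_i,C$, and expressions $A$ of the form $Q\ \mathsf{true}$ or $Q\ \mathsf{prop}$): - $\mathrm{Var}_p$ ($p\in\mathcal{V}$): no hypotheses; conclusion $\vdash p\ \mathsf{prop}$ (empty context). - $\mathrm{Self}$: from $\Gamma\vdash P\ \mathsf{prop}$ conclude $\Gamma,P\vdash P\ \mathsf{true}$. - $\mathrm{Weak}$: from $\Gamma\vdash P\ \mathsf{prop}$ and $\Gamma\vdash A$ conclude $\Gamma,P\vdash A$. - $\mathrm{Form}_c$ ($c\in\mathcal{C}$): from $\Gamma\vdash P_i\ \mathsf{prop}$ for all $0\le i<\#c$ conclude $\Gamma\vdash c(P_0,\dots,P_{\#c-1})\ \mathsf{prop}$. - $\mathrm{Intro}_c^r$ ($c\in\mathcal{C}$, $r\in\mathcal{R}(c)$): from $\Gamma\vdash P_i\ \mathcal{H}_c(r)[i]$ for all $0\le i<\#c$ conclude $\Gamma\vdash c(P_0,\dots,P_{\#c-1})\ \mathsf{true}$. - $\mathrm{Elim}_c$ ($c\in\mathcal{C}$): from $\Gamma\vdash c(P_0,\dots,P_{\#c-1})\ \mathsf{true}$ and, for each $r\in\mathcal{R}(c)$, $\Gamma,P_{i_1},\dots,P_{i_k}\vdash C\ \mathsf{true}$, where $i_1<\dots<i_k$ are the positions $i$ with $\mathcal{H}_c(r)[i]=\mathsf{true}$, conclude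 $\Gamma\vdash C\ \mathsf{true}$. **$\lambda$-calculus.** A $\lambda$-signature is a tuple $\Sigma=(\mathcal{C},\#,\mathcal{R},\mathcal{H},\mathcal{V}_{\mathsf{ty}},\mathcal{V}_{\mathsf{tm}})$, where $(\mathcal{C},\#,\mathcal{R},\mathcal{H},\mathcal{V}_{\mathsf{ty}})$ is a propositional signature and $\mathcal{V}_{\mathsf{tm}}$ is a type of individual variables. Propositions over $\Sigma$ are those over $(\mathcal{C},\#,\mathcal{R},\mathcal{H},\mathcal{V}_{\mathsf{ty}})$. Terms are built inductively: each $x\in\mathcal{V}_{\mathsf{tm}}$ is a term; for $c\in\mathcal{C}$ and $r\in\mathcal{R}(c)$, the constructor $\lambda_c^r$ applied to as many terms as there are entries $\mathsf{true}$ in $\mathcal{H}_c(r)$ is a term; for $c\in\mathcal{C}$, the eliminator $\varepsilon_c$ applied to a term $p$ together with, for each $r\in\mathcal{R}(c)$, as many individual variables as there are entries $\mathsf{true}$ in $\mathcal{H}_c(r)$ and one term $t_r$, is a term. A $\lambda$-context is a finite list $x_0:P_0,\dots,x_{n-1}:P_{n-1}$ with $x_i\in\mathcal{V}_{\mathsf{tm}}$ and $P_i$ propositions. $\mathrm{Sen}^\lambda\Sigma$ is the type of judgements $\Gamma\vdash P\ \mathsf{type}$ and $\Gamma\vdash t:P$ with $\Gamma$ a $\lambda$-context, $P$ a proposition and $t$ a term. $\pi^\lambda_\Sigma(J)$ is the type of proofs of $J$ from the following rules (for all $\lambda$-contexts $\Gamma$, propositions $P,P_i,C$, terms $t_i,p,t_r$,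 individual variables, and expressions $A$ of the form $Q\ \mathsf{type}$ or $t:Q$): - $\mathrm{Var}^\lambda_p$ ($p\in\mathcal{V}_{\mathsf{ty}}$): no hypotheses; conclusion $\vdash p\ \mathsf{type}$ (empty context). - $\mathrm{Self}^\lambda$: for $x$ not occurring in $\Gamma$, from $\Gamma\vdash P\ \mathsf{type}$ conclude $\Gamma,x:P\vdash x:P$. - $\mathrm{Weak}^\lambda$: for $x$ not occurring in $\Gamma$, from $\Gamma\vdash P\ \mathsf{type}$ and $\Gamma\vdash A$ conclude $\Gamma,x:P\vdash A$. - $\mathrm{Form}^\lambda_c$: from $\Gamma\vdash P_i\ \mathsf{type}$ for all $0\le i<\#c$ conclude $\Gamma\vdash c(P_0,\dots,P_{\#c-1})\ \mathsf{type}$. - $\mathrm{Intro}^{\lambda,r}_c$ ($r\in\mathcal{R}(c)$): given a term $t_i$ for each $i$ with $\mathcal{H}_c(r)[i]=\mathsf{true}$, from the hypotheses, for $0\le i<\#c$, $\Gamma\vdash t_i:P_i$ if $\mathcal{H}_c(r)[i]=\mathsf{true}$ and $\Gamma\vdash P_i\ \mathsf{type}$ if $\mathcal{H}_c(r)[i]=\mathsf{prop}$, conclude $\Gamma\vdash\lambda_c^r(\mathbf{t}):c(P_0,\dots,P_{\#c-1})$, where $\mathbf{t}$ is the list of the $t_i$. - $\mathrm{Elim}^\lambda_c$: from $\Gamma\vdash p:c(P_0,\dots,P_{\#c-1})$ and, for each $r\in\mathcal{R}(c)$, $\Gamma,x_{r,1}:P_{i_1},\dots,x_{r,k}:P_{i_k}\vdash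 t_r:C$, where $i_1<\dots<i_k$ are the positions $i$ with $\mathcal{H}_c(r)[i]=\mathsf{true}$, conclude $\Gamma\vdash\varepsilon_c\bigl(p,(x_{r,1},\dots,x_{r,k},t_r)_{r\in\mathcal{R}(c)}\bigr):C$. **The morphism $\mathcal{T}_{\lambda\to\mathrm{P}}=(T,\alpha,\beta)$.** It consists of the following data. - On signatures, $T(\mathcal{C},\#,\mathcal{R},\mathcal{H},\mathcal{V}_{\mathsf{ty}},\mathcal{V}_{\mathsf{tm}})=(\mathcal{C},\#,\mathcal{R},\mathcal{H},\mathcal{V}_{\mathsf{ty}})$. - For each $\lambda$-signature $\Sigma$, $\alpha_\Sigma:\mathrm{Sen}^\lambda\Sigma\to\mathrm{Sen}^{\mathrm{P}}T(\Sigma)$ sends $x_0:P_0,\dots,x_{n-1}:P_{n-1}\vdash t:P$ to $P_0,\dots,P_{n-1}\vdash P\ \mathsf{true}$, and $x_0:P_0,\dots,x_{n-1}:P_{n-1}\vdash P\ \mathsf{type}$ to $P_0,\dots,P_{n-1}\vdash P\ \mathsf{prop}$. - For each $\lambda$-signature $\Sigma$ and $J\in\mathrm{Sen}^\lambda\Sigma$, $\beta_{\Sigma,J}:\pi^\lambda_\Sigma(J)\to\pi^{\mathrm{P}}_{T(\Sigma)}(\alpha_\Sigma(J))$ is defined recursively, rule by rule: it replaces each application of $\mathrm{Var}^\lambda_p$, $\mathrm{Self}^\lambda$, $\mathrm{Weak}^\lambda$, $\mathrm{Form}^\lambda_c$, $\mathrm{Intro}^{\lambda,r}_c$, $\mathrm{Elim}^\lambda_c$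 by the application of $\mathrm{Var}_p$, $\mathrm{Self}$, $\mathrm{Weak}$, $\mathrm{Form}_c$, $\mathrm{Intro}^r_c$, $\mathrm{Elim}_c$ respectively (with the same propositions, and with individual variables and terms erased), applied to the $\beta$-images of the subproofs. *)

(* Defs.v *)
From mathcomp Require Import all_boot.
From Stdlib Require List.
Import EqNotations.

Set Implicit Arguments.
Unset Strict Implicit.
Unset Printing Implicit Defensive.

(** Used both for the entries of headers and for the two forms [P true] and
    [P prop] of propositional judgements. *)
Inductive mode : Set := mtrue | mprop.

Definition is_mtrue (m : mode) : bool := if m is mtrue then true else false.

Record prop_sig : Type := PropSig {
  conn : Type;
  arity : conn -> nat;
  rules : conn -> Type;
  header : forall c : conn, rules c -> (arity c).-tuple mode;
  pvar : Type }.

Inductive formula (S : prop_sig) : Type :=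
| Atom (p : pvar S)
| Conn (c : conn S) (P : {ffun 'I_(arity c) -> formula S}).

Inductive pexpr (S : prop_sig) : Type :=
| Assert (P : formula S) (m : mode).

(** Contexts are read from left to right: [G, P] is [rcons G P]. *)
Record pjudg (S : prop_sig) : Type := PJudg {
  pctx : seq (formula S);
  pconcl : pexpr S }.

(** [P_{i_1}, ..., P_{i_k}], with [i_1 < ... < i_k] the positions at which the
    header of [r] is [true]. *)
Definition premises (S : prop_sig) (c : conn S) (r : rules c)
    (P : {ffun 'I_(arity c) -> formula S}) : seq (formula S) :=
  [seq P i | i <- enum 'I_(arity c) & is_mtrue (tnth (header r) i)].

Inductive pproof (S : prop_sig) : pjudg S -> Type :=
| PVar (p : pvar S) :
    pproof (PJudg [::] (Assert (Atom p) mprop))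
| PSelf (G : seq (formula S)) (P : formula S) :
    pproof (PJudg G (Assert P mprop)) ->
    pproof (PJudg (rcons G P) (Assert P mtrue))
| PWeak (G : seq (formula S)) (P : formula S) (A : pexpr S) :
    pproof (PJudg G (Assert P mprop)) ->
    pproof (PJudg G A) ->
    pproof (PJudg (rcons G P) A)
| PForm (G : seq (formula S)) (c : conn S)
    (P : {ffun 'I_(arity c) -> formula S}) :
    (forall i, pproof (PJudg G (Assert (P i) mprop))) ->
    pproof (PJudg G (Assert (Conn P) mprop))
| PIntro (G : seq (formula S)) (c : conn S) (r : rules c)
    (P : {ffun 'I_(arity c) -> formula S}) :
    (forall i, pproof (PJudg G (Assert (P i) (tnth (header r) i)))) ->
    pproof (PJudg G (Assert (Conn P) mtrue))
| PElim (G : seq (formula S)) (c : conn S)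
    (P : {ffun 'I_(arity c) -> formula S}) (C : formula S) :
    pproof (PJudg G (Assert (Conn P) mtrue)) ->
    (forall r : rules c,
       pproof (PJudg (G ++ premises r P) (Assert C mtrue))) ->
    pproof (PJudg G (Assert C mtrue)).

Record lam_sig : Type := LamSig {
  prop_part : prop_sig;
  tmvar : Type }.

(** The morphism on signatures; propositions over a lambda-signature [S] are
    those over [mor_sig S]. *)
Definition mor_sig (S : lam_sig) : prop_sig := prop_part S.

(** The finite type of positions at which the header of [r] is [true]. A family
    of [k] terms or variables, [k] being the number of those positions, is
    indexed by the positions themselves. *)
Definition true_pos (S : prop_sig) (c : conn S) (r : rules c) : finType :=
  {i : 'I_(arity c) | is_mtrue (tnth (header r) i)}.

Inductive term (S : lam_sig) : Type :=
| TVar (x : tmvar S)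
| TLam (c : conn (mor_sig S)) (r : rules c) (t : {ffun true_pos r -> term S})
| TEps (c : conn (mor_sig S)) (p : term S)
    (x : forall r : rules c, {ffun true_pos r -> tmvar S})
    (t : rules c -> term S).

Arguments TLam {S c} r t.
Arguments TEps {S c} p x t.

Definition lctx (S : lam_sig) : Type := seq (tmvar S * formula (mor_sig S)).

Inductive lexpr (S : lam_sig) : Type :=
| IsType (P : formula (mor_sig S))
| HasType (t : term S) (P : formula (mor_sig S)).

Arguments IsType {S} P.

Record ljudg (S : lam_sig) : Type := LJudg {
  ljctx : lctx S;
  ljconcl : lexpr S }.

(** Stated without boolean membership, since [tmvar S] need not have decidable
    equality. *)
Definition fresh (S : lam_sig) (x : tmvar S) (G : lctx S) : Prop :=
  ~ List.In x (unzip1 G).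

(** [x_{r,1} : P_{i_1}, ..., x_{r,k} : P_{i_k}]; the enumeration of [true_pos r]
    is increasing, see [val_enum_true_pos]. *)
Definition lpremises (S : lam_sig) (c : conn (mor_sig S)) (r : rules c)
    (x : {ffun true_pos r -> tmvar S})
    (P : {ffun 'I_(arity c) -> formula (mor_sig S)}) : lctx S :=
  [seq (x i, P (val i)) | i <- enum (true_pos r)].

Inductive lproof (S : lam_sig) : ljudg S -> Type :=
| LVar (p : pvar (mor_sig S)) :
    lproof (LJudg [::] (IsType (Atom p)))
| LSelf (G : lctx S) (x : tmvar S) (P : formula (mor_sig S)) :
    fresh x G ->
    lproof (LJudg G (IsType P)) ->
    lproof (LJudg (rcons G (x, P)) (HasType (TVar x) P))
| LWeak (G : lctx S) (x : tmvar S) (P : formula (mor_sig S)) (A : lexpr S) :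
    fresh x G ->
    lproof (LJudg G (IsType P)) ->
    lproof (LJudg G A) ->
    lproof (LJudg (rcons G (x, P)) A)
| LForm (G : lctx S) (c : conn (mor_sig S))
    (P : {ffun 'I_(arity c) -> formula (mor_sig S)}) :
    (forall i, lproof (LJudg G (IsType (P i)))) ->
    lproof (LJudg G (IsType (Conn P)))
| LIntro (G : lctx S) (c : conn (mor_sig S)) (r : rules c)
    (P : {ffun 'I_(arity c) -> formula (mor_sig S)})
    (t : {ffun true_pos r -> term S}) :
    (forall i : true_pos r, lproof (LJudg G (HasType (t i) (P (val i))))) ->
    (forall i, tnth (header r) i = mprop -> lproof (LJudg G (IsType (P i)))) ->
    lproof (LJudg G (HasType (TLam r t) (Conn P)))
| LElim (G : lctx S) (c : conn (mor_sig S))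
    (P : {ffun 'I_(arity c) -> formula (mor_sig S)})
    (C : formula (mor_sig S)) (p : term S)
    (x : forall r : rules c, {ffun true_pos r -> tmvar S})
    (t : rules c -> term S) :
    lproof (LJudg G (HasType p (Conn P))) ->
    (forall r : rules c,
       lproof (LJudg (G ++ lpremises (x r) P) (HasType (t r) C))) ->
    lproof (LJudg G (HasType (TEps p x t) C)).

Definition mor_expr (S : lam_sig) (A : lexpr S) : pexpr (mor_sig S) :=
  match A with
  | IsType P => Assert P mprop
  | HasType _ P => Assert P mtrue
  end.

Definition mor_judg (S : lam_sig) (J : ljudg S) : pjudg (mor_sig S) :=
  PJudg (unzip2 (ljctx J)) (mor_expr (ljconcl J)).

Lemma val_enum_true_pos (S : prop_sig) (c : conn S) (r : rules c) :
  map val (enum (true_pos r)) =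
  [seq i <- enum 'I_(arity c) | is_mtrue (tnth (header r) i)].
Proof.
rewrite [enum (true_pos r)]enumT unlock /= enumT.
rewrite pmap_filter; last exact: insubK.
by apply: eq_filter => i; apply: isSome_insub.
Qed.

Lemma unzip2_rcons (S : lam_sig) (G : lctx S) (x : tmvar S)
    (P : formula (mor_sig S)) :
  unzip2 (rcons G (x, P)) = rcons (unzip2 G) P.
Proof. exact: map_rcons. Qed.

Lemma unzip2_lpremises (S : lam_sig) (G : lctx S) (c : conn (mor_sig S))
    (r : rules c) (x : {ffun true_pos r -> tmvar S})
    (P : {ffun 'I_(arity c) -> formula (mor_sig S)}) :
  unzip2 (G ++ lpremises x P) = unzip2 G ++ premises r P.
Proof.
rewrite /unzip2 map_cat; congr (_ ++ _).
by rewrite /premises -val_enum_true_pos /lpremises -!map_comp.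
Qed.

(** Erasing variables commutes with context extension only propositionally, so
    [mor_proof] transports along the equation between the two contexts. *)
Definition cast_ctx (S : prop_sig) (G G' : seq (formula S)) (A : pexpr S)
    (e : G = G') (d : pproof (PJudg G A)) : pproof (PJudg G' A) :=
  rew [fun H => pproof (PJudg H A)] e in d.

Fixpoint mor_proof (S : lam_sig) (J : ljudg S) (d : lproof J) :
    pproof (mor_judg J) :=
  match d in lproof J return pproof (mor_judg J) with
  | LVar p => PVar p
  | LSelf G x P _ dP =>
      cast_ctx (esym (unzip2_rcons G x P)) (PSelf (mor_proof dP))
  | LWeak G x P A _ dP dA =>
      cast_ctx (esym (unzip2_rcons G x P))
        (PWeak (mor_proof dP) (mor_proof dA))
  | LForm G c P dP => PForm (fun i => mor_proof (dP i))
  | LIntro G c r P t dt dP =>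
      PIntro (fun i =>
        match tnth (header r) i as m return
          tnth (header r) i = m -> pproof (PJudg (unzip2 G) (Assert (P i) m))
        with
        | mtrue => fun e => mor_proof (dt (Sub i (congr1 is_mtrue e)))
        | mprop => fun e => mor_proof (dP i e)
        end erefl)
  | LElim G c P C p x t dp dt =>
      PElim (mor_proof dp)
        (fun r => cast_ctx (unzip2_lpremises G (x r) P) (mor_proof (dt r)))
  end.

Definition transport_judg (S S' : prop_sig) (e : S = S') (J : pjudg S) :
    pjudg S' := rew [pjudg] e in J.

Definition transport_proof (S S' : prop_sig) (e : S = S') (J : pjudg S)
    (d : pproof J) : pproof (transport_judg e J) :=
  match e as e0 in _ = S0 return pproof (transport_judg e0 J) with
  | erefl => d
  end.

(* Main.v *)
Require Import Defs.
From mathcomp Require Import all_boot.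
From Stdlib Require Import FunctionalExtensionality Eqdep.
Import EqNotations.

Set Implicit Arguments.
Unset Strict Implicit.
Unset Printing Implicit Defensive.

(** Erasure forgets only terms and variables, so a propositional proof is lifted
    rule by rule once names are supplied for the assumptions of its contexts.
    Take the natural numbers as individual variables. The claim proved by
    induction on a propositional proof [d] ([lift_proof]) is that over _every_
    pairwise distinct naming of its context there are a term and a typing proof
    that erase to [d]. Quantifying over the naming is what makes the induction
    go through: the subproofs of one node must be lifted over namings that agree
    with each other. Distinctness of the names gives exactly the freshness
    required by the self and weakening rules. An elimination extends the context, and its
    new assumptions are named by numbers beyond all names in use.

    Connectives may have infinitely many rules, so the terms of the branches of
    an elimination have to be produced as a function of the rule. Lifts are
    therefore data ([lift]), from which such a function can be read off, rather
    than existence statements.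

    The erased contexts agree with the given ones only up to propositional
    equality. Uniqueness of identity proofs makes the result of transporting a
    proof independent of the equation used, and functional extensionality
    identifies two families of subproofs that agree at every index. *)

(** * Lifts of propositional proofs *)

Definition nat_sig (SP : prop_sig) : lam_sig := LamSig SP nat.

(** The fibre of [mor_proof] over [d], restricted to lambda-judgements with
    context [G]. Splitting on the mode pins down the shape of the typed judgement,
    so that the rules of the lambda-calculus apply to it directly. *)
Definition lift (SL : lam_sig) (G : lctx SL) (A : pexpr (mor_sig SL)) :
    pproof (PJudg (unzip2 G) A) -> Type :=
  match A with
  | Assert P mprop => fun d =>
      {dL : lproof (LJudg G (IsType P)) | mor_proof dL = d}
  | Assert P mtrue => fun d =>
      {t : term SL & {dL : lproof (LJudg G (HasType t P)) | mor_proof dL = d}}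
  end.

Lemma cast_ctxKV (S : prop_sig) (G G' : seq (formula S)) (A : pexpr S)
    (e : G = G') (d : pproof (PJudg G' A)) :
  cast_ctx e (cast_ctx (esym e) d) = d.
Proof. by case: G' / e d. Qed.

(** Needed because the term [t i] of an introduction is the value of a finite
    function, equal to the term of the lifted hypothesis only up to [ffunE]. *)
Lemma mor_proof_retype (SL : lam_sig) (G : lctx SL) (t t' : term SL)
    (P : formula (mor_sig SL)) (e : t = t')
    (dL : lproof (LJudg G (HasType t P))) :
  mor_proof (rew [fun u => lproof (LJudg G (HasType u P))] e in dL)
  = mor_proof dL.
Proof. by case: t' / e. Qed.

(** * Contexts with distinct names *)

Lemma mem_In (T : eqType) (x : T) (s : seq T) : List.In x s -> x \in s.
Proof.
by elim: s => //= y s IHs [->|/IHs xs]; rewrite inE ?eqxx // xs orbT.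
Qed.

Lemma uniq_rcons_fresh (SP : prop_sig) (G : lctx (nat_sig SP)) (x : nat)
    (P : formula SP) :
  uniq (unzip1 (rcons G (x, P)) : seq nat) ->
  @fresh (nat_sig SP) x G /\ uniq (unzip1 G : seq nat).
Proof.
rewrite /unzip1 map_rcons rcons_uniq => /andP[/negP xG uG].
by split=> // /(@mem_In nat).
Qed.

Definition next_name (s : seq nat) : nat := (\max_(y <- s) y).+1.

Lemma mem_lt_next_name (s : seq nat) (y : nat) : y \in s -> y < next_name s.
Proof. by move=> ys; rewrite ltnS; apply: (@leq_bigmax_seq _ s xpredT id). Qed.

Definition elim_names (SP : prop_sig) (G : lctx (nat_sig SP)) (c : conn SP)
    (r : rules c) : {ffun true_pos r -> nat} :=
  [ffun i => next_name (unzip1 G) + enum_rank i].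

Lemma uniq_elim_names (SP : prop_sig) (G : lctx (nat_sig SP)) (c : conn SP)
    (r : rules c) (P : {ffun 'I_(arity c) -> formula SP}) :
  uniq (unzip1 G : seq nat) ->
  uniq (unzip1 (G ++ @lpremises (nat_sig SP) c r (elim_names G r) P) : seq nat).
Proof.
move=> uG; rewrite /unzip1 map_cat cat_uniq uG /=.
have -> : map fst (@lpremises (nat_sig SP) c r (elim_names G r) P)
    = map (elim_names G r) (enum (true_pos r)).
  by rewrite /lpremises -map_comp.
apply/andP; split; last first.
  rewrite map_inj_uniq ?enum_uniq // => i j.
  by rewrite !ffunE => /addnI/val_inj/enum_rank_inj.
apply/hasPn => _ /mapP[i _ ->]; apply/negP => /mem_lt_next_name.
by rewrite ffunE ltnNge leq_addr.
Qed.

Lemma exists_naming (SP : prop_sig) (G0 : seq (formula SP)) :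
  exists2 G : lctx (nat_sig SP), uniq (unzip1 G : seq nat) & unzip2 G = G0.
Proof.
exists (zip (iota 0 (size G0)) G0 : lctx (nat_sig SP)).
  by rewrite [unzip1 _](@unzip1_zip nat) ?size_iota // iota_uniq.
by rewrite [unzip2 _](@unzip2_zip nat) ?size_iota.
Qed.

(** * Lifting each rule *)

(** Brings a named version of an extended context into the form in which the self
    and weakening rules conclude. The given equation has to be replaced by
    [unzip2_rcons], along which [mor_proof] transports; as equality of formulas
    need not be decidable, this appeals to uniqueness of identity proofs. *)
Lemma rcons_naming (SP : prop_sig) (G0 : seq (formula SP)) (P : formula SP)
    (R : forall G : lctx (nat_sig SP), unzip2 G = rcons G0 P -> Type) :
  (forall (G : lctx (nat_sig SP)) (x : nat) (e : unzip2 G = G0),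
     R (rcons G (x, P))
       (rew [fun H => _ = rcons H P] e in @unzip2_rcons (nat_sig SP) G x P)) ->
  forall G e, R G e.
Proof.
move=> RP G; case/lastP: G => [|G [x Q]] e.
  by have := congr1 size e; rewrite size_rcons.
have [eG eQ] := rcons_inj (etrans (esym (@unzip2_rcons (nat_sig SP) G x Q)) e).
case: P / eQ R RP e => R RP e.
have := RP G x eG; set e' := rew _ in _ => Re'.
by rewrite (UIP _ _ _ e e').
Qed.

Lemma lift_self (SL : lam_sig) (G : lctx SL) (x : tmvar SL)
    (P : formula (mor_sig SL))
    (d : pproof (PJudg (unzip2 G) (Assert P mprop))) :
  fresh x G -> lift d ->
  lift (cast_ctx (esym (unzip2_rcons G x P)) (PSelf d)).
Proof.
by move=> xG [dL <-]; exists (TVar x), (LSelf xG dL).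
Qed.

Lemma lift_weak (SL : lam_sig) (G : lctx SL) (x : tmvar SL)
    (P : formula (mor_sig SL)) (A : pexpr (mor_sig SL))
    (d : pproof (PJudg (unzip2 G) (Assert P mprop)))
    (d' : pproof (PJudg (unzip2 G) A)) :
  fresh x G -> lift d -> lift d' ->
  lift (cast_ctx (esym (unzip2_rcons G x P)) (PWeak d d')).
Proof.
case: A d' => Q [] d' xG [dL <-].
  by move=> [t [dL' <-]]; exists t, (LWeak xG dL dL').
by move=> [dL' <-]; exists (LWeak xG dL dL').
Qed.

Lemma lift_form (SL : lam_sig) (G : lctx SL) (c : conn (mor_sig SL))
    (P : {ffun 'I_(arity c) -> formula (mor_sig SL)})
    (d : forall i, pproof (PJudg (unzip2 G) (Assert (P i) mprop))) :
  (forall i, lift (d i)) -> lift (PForm d).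
Proof.
move=> dL; exists (LForm (fun i => sval (dL i))) => /=.
by congr PForm; apply: functional_extensionality_dep => i; case: (dL i).
Qed.

Definition cast_mode (S : prop_sig) (G : seq (formula S)) (P : formula S)
    (m m' : mode) (e : m = m') (d : pproof (PJudg G (Assert P m))) :
    pproof (PJudg G (Assert P m')) :=
  rew [fun k => pproof (PJudg G (Assert P k))] e in d.

(** Whether a hypothesis of an introduction is lifted with a term or without one
    depends on its entry in the header, which is known only through an equation;
    so the hypotheses are first moved along that equation. *)
Lemma lift_intro (SL : lam_sig) (G : lctx SL) (c : conn (mor_sig SL))
    (r : rules c) (P : {ffun 'I_(arity c) -> formula (mor_sig SL)})
    (d : forall i, pproof (PJudg (unzip2 G) (Assert (P i) (tnth (header r) i)))) :
  (forall i, lift (d i)) -> lift (PIntro d).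
Proof.
move=> dL.
have dLm i m (e : tnth (header r) i = m) : lift (cast_mode e (d i)).
  by case: m / e; apply: dL.
have mode_true (i : true_pos r) : tnth (header r) (val i) = mtrue.
  by have := valP i; case: (tnth _ _).
pose tL i := dLm (val i) mtrue (mode_true i).
pose t := [ffun i => projT1 (tL i)].
have tE i : projT1 (tL i) = t i by rewrite ffunE.
pose dt i := rew [fun u => lproof (LJudg G (HasType u (P (val i))))] tE i
             in sval (projT2 (tL i)).
have dtE i : mor_proof (dt i) = cast_mode (mode_true i) (d (val i)).
  by rewrite /dt mor_proof_retype; case: (projT2 (tL i)).
pose dp i e := sval (dLm i mprop e).
(* The dependent case analysis by which [mor_proof] treats the hypothesis [i],
   for an arbitrary equation: with reflexivity the entry could not be varied. *)
have mor_hyp i m (e : tnth (header r) i = m) :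
    match m return tnth (header r) i = m ->
                   pproof (PJudg (unzip2 G) (Assert (P i) m)) with
    | mtrue => fun e => mor_proof (dt (Sub i (congr1 is_mtrue e)))
    | mprop => fun e => mor_proof (dp i e)
    end e = cast_mode e (d i).
  case: m e => e; last by rewrite /dp; case: (dLm i mprop e).
  rewrite dtE; exact: (congr1 (fun q => cast_mode q (d i)) (UIP _ _ _ _ _)).
exists (TLam r t), (LIntro dt dp) => /=.
congr PIntro; apply: functional_extensionality_dep => i.
exact: mor_hyp (erefl _).
Qed.

(** The names [x] of the new assumptions are a parameter, to be chosen so that
    lifts of the branches are available: [lift_proof] provides them over contexts
    with distinct names. *)
Lemma lift_elim (SL : lam_sig) (G : lctx SL) (c : conn (mor_sig SL))
    (P : {ffun 'I_(arity c) -> formula (mor_sig SL)}) (C : formula (mor_sig SL))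
    (x : forall r : rules c, {ffun true_pos r -> tmvar SL})
    (d : pproof (PJudg (unzip2 G) (Assert (Conn P) mtrue)))
    (d' : forall r : rules c,
      pproof (PJudg (unzip2 G ++ premises r P) (Assert C mtrue))) :
  lift d ->
  (forall r, lift (cast_ctx (esym (unzip2_lpremises G (x r) P)) (d' r))) ->
  lift (PElim d d').
Proof.
move=> [p [dp <-]] dL.
exists (TEps p x (fun r => projT1 (dL r))).
exists (LElim dp (fun r => sval (projT2 (dL r)))) => /=.
congr PElim; apply: functional_extensionality_dep => r.
by case: (projT2 (dL r)) => dr /= ->; apply: cast_ctxKV.
Qed.

(** * Lifting proofs *)

(** The strengthened induction hypothesis: all namings [G] of the context, rather
    than a single one chosen in advance, since weakening drops a name and
    elimination adds some. *)
Definition liftable (SP : prop_sig) (J : pjudg SP) : pproof J -> Type :=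
  match J with
  | PJudg G0 A => fun d =>
      forall (G : lctx (nat_sig SP)) (e : unzip2 G = G0),
        uniq (unzip1 G : seq nat) ->
        lift (SL := nat_sig SP) (cast_ctx (esym e) d)
  end.

Lemma lift_proof (SP : prop_sig) (J : pjudg SP) (d : pproof J) : liftable d.
Proof.
elim: J / d => [p|G0 P d IHd|G0 P A d IHd d' IHd'|G0 c P d IHd|G0 c r P d IHd
               |G0 c P C d IHd d' IHd'] /=.
- move=> [|//] e _; rewrite (UIP _ _ _ e erefl).
  by exists (@LVar (nat_sig SP) p).
- apply: rcons_naming => G x eG /uniq_rcons_fresh[xG uG].
  have {IHd} := IHd G eG uG; case: G0 / eG d => d dL.
  exact: (@lift_self (nat_sig SP)).
- apply: rcons_naming => G x eG /uniq_rcons_fresh[xG uG].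
  have {IHd} := IHd G eG uG; have {IHd'} := IHd' G eG uG.
  case: G0 / eG d d' => d d' dL' dL.
  exact: (@lift_weak (nat_sig SP)).
- move=> G e uG; have {IHd} dL i := IHd i G e uG.
  by case: G0 / e d dL => d dL; apply: (@lift_form (nat_sig SP)).
- move=> G e uG; have {IHd} dL i := IHd i G e uG.
  by case: G0 / e d dL => d dL; apply: (@lift_intro (nat_sig SP)).
- move=> G e uG; have {IHd} := IHd G e uG.
  case: G0 / e d d' IHd' => d d' IHd' dL.
  apply: (@lift_elim (nat_sig SP) _ _ _ _ (fun r => elim_names G r)) => // r.
  exact/IHd'/uniq_elim_names.
Qed.

Theorem mainTheorem1 (SP : prop_sig) (JP : pjudg SP) (dP : pproof JP) :
  exists (SL : lam_sig) (JL : ljudg SL) (dL : lproof JL)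
    (eS : mor_sig SL = SP) (eJ : transport_judg eS (mor_judg JL) = JP),
    rew [fun J => pproof J] eJ in transport_proof eS (mor_proof dL) = dP.
Proof.
case: JP dP => G0 A dP; have [G uG eG] := exists_naming G0.
case: G0 / eG dP => dP; exists (nat_sig SP).
case: A dP => P [] dP; have := lift_proof dP G erefl uG.
  by move=> [t [dL dLE]]; exists (LJudg G (HasType t P)), dL, erefl, erefl.
by move=> [dL dLE]; exists (LJudg G (@IsType (nat_sig SP) P)), dL, erefl, erefl.
Qed.
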